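(* Let $X$ be a normed space, $n>1$, $\Omega_1,\ldots,\Omega_n\subset X$ nonempty, $\widehat\Omega:=\Omega_1\times\cdots\times\Omega_n$, $\sigma_{\mathbf{x}}=\{\mathbf{x}^k\}\subset\widehat\Omega$, $\mathbf{x}^k=(x_1^k,\ldots,x_n^k)$, and $\alpha>0$. Let $\sigma_{\mathbf{u}}:=\{\mathbf{u}^k\}\subset\widehat\Omega$ and $\mathbf{u}^k-\mathbf{x}^k\to0$ as $k\to+\infty$. Let $P$ stand for any of the properties: extremality, global extremality, approximate $\alpha$-stationarity, approximate stationarity. Then $\{\Omega_1,\ldots,\Omega_n\}$ has property $P$ at $\sigma_{\mathbf{x}}$ if and only if it has property $P$ at $\sigma_{\mathbf{u}}$. In particular, if $x_i^k\to\bar x$ as $k\to+\infty$ for some $\bar x\in\bigcap_{i=1}^n\Omega_i$ and all $i=1,\ldots,n$, then $\{\Omega_1,\ldots,\Omega_n\}$ has property $P$ at $\bar x$ if and only if it has property $P$ at $\sigma_{\mathbf{x}}$.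
   Context: Notation. $X^n$ carries the maximum norm; $d(x,\emptyset)=+\infty$. For $\mathbf{x}=(x_1,\ldots,x_n)\in X^n$, $\zeta(\mathbf{x}):=d\big(0,\bigcap_{i=1}^n(\Omega_i-x_i)\big)$. For $c>0$, $c/0:=+\infty$ and $c/(+\infty):=0$. For $\sigma_{\mathbf{x}}=\{\mathbf{x}^k\}\subset\widehat\Omega$ and $\sigma_{\mathbf{a}}=\{\mathbf{a}^k\}\subset X^n\setminus\{0\}$ with $\mathbf{a}^k\to0$, put $$\rho(\sigma_{\mathbf{x}};\sigma_{\mathbf{a}}):=\liminf_{k\to+\infty}\zeta(\mathbf{x}^k+\mathbf{a}^k),\qquad\alpha(\sigma_{\mathbf{x}};\sigma_{\mathbf{a}}):=\limsup_{k\to+\infty}\frac{\|\mathbf{a}^k\|}{\zeta(\mathbf{x}^k+\mathbf{a}^k)},$$ $$\widetilde\alpha(\sigma_{\mathbf{x}};\sigma_{\mathbf{a}}):=\inf\big\{\alpha(\sigma_{\mathbf{u}};\sigma_{\mathbf{a}})\mid \sigma_{\mathbf{u}}=\{\mathbf{u}^k\}\subset\widehat\Omega,\ \mathbf{u}^k-\mathbf{x}^k\to0\big\}.$$ The collection $\{\Omega_1,\ldots,\Omega_n\}$ is extremal, globally extremal, approximately $\alpha$-stationary, approximately stationary at $\sigma_{\mathbf{x}}$ if there exists a sequence $\sigma_{\mathbf{a}}=\{\mathbf{a}^k\}\subset X^n\setminus\{0\}$ with $\mathbf{a}^k\to0$ such that, respectively, $\rho(\sigma_{\mathbf{x}};\sigma_{\mathbf{a}})>0$,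 $\rho(\sigma_{\mathbf{x}};\sigma_{\mathbf{a}})=+\infty$, $\widetilde\alpha(\sigma_{\mathbf{x}};\sigma_{\mathbf{a}})<\alpha$, $\widetilde\alpha(\sigma_{\mathbf{x}};\sigma_{\mathbf{a}})=0$. For $\bar x\in\bigcap_i\Omega_i$, a property ''at $\bar x$'' means the property at the constant sequence $\mathbf{x}^k=(\bar x,\ldots,\bar x)$. *)

(* Defs.v *)
From HB Require Import structures.
From mathcomp Require Import all_boot all_order all_algebra.
From mathcomp Require Import all_classical all_reals all_analysis.

Set Implicit Arguments.
Unset Strict Implicit.
Unset Printing Implicit Defensive.

Import Order.TTheory GRing.Theory Num.Theory.
Import numFieldNormedType.Exports.

Local Open Scope classical_set_scope.
Local Open Scope ring_scope.

(* Elements of X^n are functions 'I_n -> X.  The library only equips matrices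
   over the scalars with a norm, so the maximum norm of X^n is given here. *)
Definition maxnorm (R : realType) (X : normedModType R) (n : nat)
    (x : 'I_n -> X) : R :=
  \big[Num.max/0]_(i < n) `|x i|.

Definition null_seq (R : realType) (X : normedModType R) (n : nat)
    (a : nat -> 'I_n -> X) : Prop :=
  maxnorm (a k) @[k --> \oo] --> (0 : R).

Definition in_prod (R : realType) (X : normedModType R) (n : nat)
    (Omega : 'I_n -> set X) (x : nat -> 'I_n -> X) : Prop :=
  forall k i, Omega i (x k i).

Definition perturbation (R : realType) (X : normedModType R) (n : nat)
    (a : nat -> 'I_n -> X) : Prop :=
  (forall k, a k != 0) /\ null_seq a.

(* [edist_inf A z] is ereal_inf of [edist (z, w)] over w in A, hence +oo when A
   is empty; in a normed space [edist (z, w)] is the norm of z - w. *)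
Definition zeta (R : realType) (X : normedModType R) (n : nat)
    (Omega : 'I_n -> set X) (x : 'I_n -> X) : \bar R :=
  edist_inf (\bigcap_(i in [set: 'I_n]) [set w - x i | w in Omega i]) 0.

Definition rho (R : realType) (X : normedModType R) (n : nat)
    (Omega : 'I_n -> set X) (x a : nat -> 'I_n -> X) : \bar R :=
  limn_einf (fun k => zeta Omega (x k + a k)%R).

(* In \bar R the library sets 0^-1 = +oo and +oo^-1 = 0; hence, for c > 0,
   c%:E / 0 = +oo and c%:E / +oo = 0. *)
Definition alpha_at (R : realType) (X : normedModType R) (n : nat)
    (Omega : 'I_n -> set X) (x a : nat -> 'I_n -> X) : \bar R :=
  limn_esup (fun k => (maxnorm (a k))%:E / zeta Omega (x k + a k)%R)%E.

Definition alpha_tilde (R : realType) (X : normedModType R) (n : nat)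
    (Omega : 'I_n -> set X) (x a : nat -> 'I_n -> X) : \bar R :=
  ereal_inf [set alpha_at Omega u a |
    u in [set u | in_prod Omega u /\ null_seq (fun k => u k - x k)]].

Definition extremal (R : realType) (X : normedModType R) (n : nat)
    (Omega : 'I_n -> set X) (x : nat -> 'I_n -> X) : Prop :=
  exists a, perturbation a /\ (0 < rho Omega x a)%E.

Definition globally_extremal (R : realType) (X : normedModType R) (n : nat)
    (Omega : 'I_n -> set X) (x : nat -> 'I_n -> X) : Prop :=
  exists a, perturbation a /\ rho Omega x a = +oo%E.

Definition approx_alpha_stationary (R : realType) (X : normedModType R)
    (n : nat) (Omega : 'I_n -> set X) (alpha : R) (x : nat -> 'I_n -> X) :
    Prop :=
  exists a, perturbation a /\ (alpha_tilde Omega x a < alpha%:E)%E.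

Definition approx_stationary (R : realType) (X : normedModType R) (n : nat)
    (Omega : 'I_n -> set X) (x : nat -> 'I_n -> X) : Prop :=
  exists a, perturbation a /\ alpha_tilde Omega x a = 0%E.

Inductive property : Set :=
  | Extremality
  | GlobalExtremality
  | ApproxAlphaStationarity
  | ApproxStationarity.

(* [alpha] only matters for [ApproxAlphaStationarity]. *)
Definition has_property_at (R : realType) (X : normedModType R) (n : nat)
    (Omega : 'I_n -> set X) (alpha : R) (P : property)
    (x : nat -> 'I_n -> X) : Prop :=
  match P with
  | Extremality => extremal Omega x
  | GlobalExtremality => globally_extremal Omega x
  | ApproxAlphaStationarity => approx_alpha_stationary Omega alpha x
  | ApproxStationarity => approx_stationary Omega x
  end.

Definition has_property_at_point (R : realType) (X : normedModType R)
    (n : nat) (Omega : 'I_n -> set X) (alpha : R) (P : property) (xbar : X) :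
    Prop :=
  has_property_at Omega alpha P (fun _ _ => xbar).

(* Main.v *)
(* Approximate stationarity is invariant because alpha_tilde only depends on the
   class of the sequence modulo null sequences.  For the two extremalities,
   the translations a are replaced by a' = x + a - u, so that u + a' = x + a;
   where this a' vanishes, x + a = u has zeta equal to 0, and keeping a' = a
   there can only increase zeta. *)

Require Import Defs.
From HB Require Import structures.
From mathcomp Require Import all_boot all_order all_algebra.
From mathcomp Require Import all_classical all_reals all_analysis.

Set Implicit Arguments.
Unset Strict Implicit.
Unset Printing Implicit Defensive.

Import Order.TTheory GRing.Theory Num.Theory.
Import numFieldNormedType.Exports.

Local Open Scope classical_set_scope.
Local Open Scope ring_scope.

(** The lower limit is the limit of the infima over tails, which always converges in [\bar R]; the
    comparison is made tail by tail. *)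
Lemma limn_einf_le (R : realType) (f g : nat -> \bar R) :
  (forall k, f k <= g k)%E -> (limn_einf f <= limn_einf g)%E.
Proof.
move=> fg; rewrite !limn_einf_lim.
apply: lee_lim; [exact: is_cvg_einfs|exact: is_cvg_einfs|].
near=> m; apply: le_ereal_inf_tmp => _ [k mk <-].
by apply: le_trans (fg k); apply: ereal_inf_lbound; exists k.
Unshelve. all: by end_near. Qed.

Section null_sequences.
Context {R : realType} {X : normedModType R} {n : nat}.
Implicit Types (x y : 'I_n -> X) (a b c : nat -> 'I_n -> X).

Lemma maxnorm_ge0 x : 0 <= maxnorm x.
Proof. by rewrite /maxnorm; elim/big_ind: _ => // p q p0 q0; rewrite le_max p0. Qed.

Lemma maxnormN x : maxnorm (- x) = maxnorm x.
Proof. by apply: eq_bigr => i _; rewrite opprfctE normrN. Qed.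

Lemma maxnormD x y : maxnorm (x + y) <= maxnorm x + maxnorm y.
Proof.
apply: bigmax_le => [|i _]; first by rewrite addr_ge0 ?maxnorm_ge0.
by rewrite (le_trans (ler_normD _ _))// lerD// /maxnorm le_bigmax.
Qed.

Lemma maxnorm_le_sum x : maxnorm x <= \sum_(i < n) `|x i|.
Proof.
apply: bigmax_le => [|i _]; first by rewrite sumr_ge0.
by rewrite (bigD1 i)//= lerDl sumr_ge0.
Qed.

(** Squeeze between 0 and a sum of null sequences. It yields both transitivity of equivalence modulo
    null sequences and the smallness of the modified translations. *)
Lemma null_seq_le a b c :
  (forall k, maxnorm (c k) <= maxnorm (a k) + maxnorm (b k)) ->
  null_seq a -> null_seq b -> null_seq c.
Proof.
move=> cab a0 b0.
apply: (squeeze_cvgr (f := fun=> 0)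
  (h := fun k => maxnorm (a k) + maxnorm (b k))).
- by apply: nearW => k; rewrite maxnorm_ge0 cab.
- exact: cvg_cst.
- by rewrite -[X in _ --> X](addr0 0); exact: cvgD.
Qed.

Lemma null_seq_coord a : (forall i, a k i @[k --> \oo] --> 0) -> null_seq a.
Proof.
move=> a0.
apply: (squeeze_cvgr (f := fun=> 0) (h := fun k => \sum_(i < n) `|a k i|)).
- by apply: nearW => k; rewrite maxnorm_ge0 maxnorm_le_sum.
- exact: cvg_cst.
(* The limit is written as a sum of zeros, so that convergence can be taken term by term. *)
- rewrite [X in _ --> X](_ : 0 = \sum_(i < n) 0); last by rewrite big1.
  by apply: cvg_big => [|i _]; [exact: add_continuous|exact/norm_cvg0P].
Qed.

Lemma null_seq_sym a b :
  null_seq (fun k => a k - b k) -> null_seq (fun k => b k - a k).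
Proof.
rewrite /null_seq; under eq_fun do rewrite -maxnormN opprB.
by [].
Qed.

Lemma null_seq_trans a b c :
  null_seq (fun k => a k - b k) -> null_seq (fun k => b k - c k) ->
  null_seq (fun k => a k - c k).
Proof. by apply: null_seq_le => k; rewrite -(subrKA (b k)) maxnormD. Qed.

End null_sequences.

Section equivalent_sequences.
Context {R : realType} {X : normedModType R} {n : nat} (Omega : 'I_n -> set X).
Implicit Types (x u a : nat -> 'I_n -> X).

Lemma zeta_ge0 (z : 'I_n -> X) : (0 <= zeta Omega z)%E.
Proof. exact: edist_inf_ge0. Qed.

(** Each translate of [Omega i] by [- z i] contains the origin, as the image of [z i]. *)
Lemma zeta_in_prod (z : 'I_n -> X) :
  (forall i, Omega i (z i)) -> zeta Omega z = 0%E.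
Proof. by move=> Oz; apply: edist_inf0 => i _; exists (z i); rewrite ?subrr. Qed.

(** One inequality serves both extremalities: being positive and being [+oo] each pass to a larger
    [rho]. *)
Lemma rho_transfer x u a : in_prod Omega u ->
  null_seq (fun k => u k - x k) -> perturbation a ->
  exists2 b, perturbation b & (rho Omega x a <= rho Omega u b)%E.
Proof.
move=> uO ux [an0 a0].
pose b k := if x k + a k - u k == 0 then a k else x k + a k - u k.
exists b; last first.
  apply: limn_einf_le => k; rewrite /b; case: ifPn => [|_].
    by rewrite subr_eq0 => /eqP ->; rewrite zeta_in_prod// zeta_ge0.
  by rewrite subrKC.
split=> [k|]; first by rewrite /b; case: ifPn.
apply: null_seq_le a0 ux => k; rewrite /b; case: ifPn => _.
  by rewrite lerDl maxnorm_ge0.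
(* Regroup [x k + a k - u k] as [a k + (x k - u k)]. *)
by rewrite -(maxnormN (u k - x k)) opprB -addrA addrCA maxnormD.
Qed.

Lemma alpha_tilde_equiv x u a : null_seq (fun k => u k - x k) ->
  alpha_tilde Omega x a = alpha_tilde Omega u a.
Proof.
move=> ux; congr (ereal_inf (image _ _)).
(* Both infima range over the same sequences [v], by symmetry and transitivity. *)
apply/seteqP; split=> v [vO vx]; split=> //.
  exact/(null_seq_trans vx)/null_seq_sym.
exact: null_seq_trans vx ux.
Qed.

Lemma has_property_at_equiv alpha P x u : in_prod Omega u ->
  null_seq (fun k => u k - x k) ->
  has_property_at Omega alpha P x -> has_property_at Omega alpha P u.
Proof.
move=> uO ux; case: P => -[a [pa]].
- have [b pb ab] := rho_transfer uO ux pa => a0.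
  by exists b; split=> //; exact: lt_le_trans ab.
- have [b pb ab] := rho_transfer uO ux pa => ay.
  by exists b; split=> //; apply/eqP; rewrite -leye_eq -ay.
(* For both stationarities the same [a] works at [u]. *)
- by rewrite (alpha_tilde_equiv _ ux); exists a.
- by rewrite (alpha_tilde_equiv _ ux); exists a.
Qed.

End equivalent_sequences.

Theorem proposition2p7 (R : realType) (X : normedModType R) (n : nat)
    (hn : (1 < n)%N) (Omega : 'I_n -> set X)
    (hOmega : forall i, Omega i !=set0)
    (x : nat -> 'I_n -> X) (hx : in_prod Omega x)
    (alpha : R) (halpha : 0 < alpha) (P : property) :
  (forall u : nat -> 'I_n -> X,
      in_prod Omega u -> null_seq (fun k => u k - x k) ->
      (has_property_at Omega alpha P x <-> has_property_at Omega alpha P u)) /\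
  (forall xbar : X,
      (forall i, Omega i xbar) ->
      (forall i, x k i @[k --> \oo] --> xbar) ->
      (has_property_at_point Omega alpha P xbar <->
       has_property_at Omega alpha P x)).
Proof.
have equiv y u : in_prod Omega y -> in_prod Omega u ->
    null_seq (fun k => u k - y k) ->
    has_property_at Omega alpha P y <-> has_property_at Omega alpha P u.
  move=> yO uO uy; split; apply: has_property_at_equiv => //.
  exact: null_seq_sym.
split=> [u uO ux|xbar xbarO xxbar]; first exact: equiv.
(* The constant sequence [xbar] plays the role of [y], and [x] that of [u]. *)
apply: equiv => //; apply: null_seq_coord => i.
by apply/subr_cvg0; exact: xxbar.
Qed.
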